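(* $\mathcal{TC}(\mathrm{UF})=\mathrm{CS}$.
   Context: A language is union-free if it can be described by a regular expression built only using concatenation (product) and Kleene star (from the atomic expressions $\emptyset$ and single letters); $\mathrm{UF}$ is the family of union-free languages. A tree-controlled grammar is a quintuple $G=(N,T,P,S,R)$ where $(N,T,P,S)$ is a context-free grammar whose rules are all non-erasing, except that $S\to\lambda$ is allowed if $S$ does not occur on the right-hand side of any rule, and $R\subseteq (N\cup T)^*$ is a regular control language. The word of level $j$ of a derivation tree is the word of all nodes of depth $j$ read left to right. $L(G)$ consists of all $z\in T^*$ having a derivation tree with yield $z$ such that the words of all levels except the last belong to $R$. For a family $\mathcal F$ of regular languages, $\mathcal{TC}(\mathcal F)$ is the family of languages generated by tree-controlled grammars with control language in $\mathcal F$. $\mathrm{CS}$ is the family of context-sensitive languages. *)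

(* Defs.v *)
From Stdlib Require Import Relations.
From Stdlib Require List.
From mathcomp Require Import all_boot.
Set Implicit Arguments. Unset Strict Implicit. Unset Printing Implicit Defensive.

Inductive uf_expr (V : Type) : Type :=
  | UF_empty : uf_expr V
  | UF_sym : V -> uf_expr V
  | UF_cat : uf_expr V -> uf_expr V -> uf_expr V
  | UF_star : uf_expr V -> uf_expr V.

Inductive uf_lang (V : Type) : uf_expr V -> seq V -> Prop :=
  | UFL_sym a : uf_lang (UF_sym a) [:: a]
  | UFL_cat e1 e2 u v : uf_lang e1 u -> uf_lang e2 v -> uf_lang (UF_cat e1 e2) (u ++ v)
  | UFL_star_nil e : uf_lang (UF_star e) [::]
  | UFL_star_cons e u v :
      uf_lang e u -> uf_lang (UF_star e) v -> uf_lang (UF_star e) (u ++ v).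

Definition union_free (V : Type) (R : seq V -> Prop) : Prop :=
  exists e : uf_expr V, forall w, R w <-> uf_lang e w.

(* Nodes: terminal leaves, lambda leaves (only below a rule A -> lambda),
   and nonterminal nodes with their ordered children. *)
Inductive dtree (N T : Type) : Type :=
  | DLeaf : T -> dtree N T
  | DEps : dtree N T
  | DNode : N -> seq (dtree N T) -> dtree N T.

Arguments DEps {N T}.

Definition root_sym (N T : Type) (t : dtree N T) : seq (N + T) :=
  match t with
  | DLeaf a => [:: inr a]
  | DEps => [::]
  | DNode A _ => [:: inl A]
  end.

Inductive valid_tree (N T : eqType) (P : seq (N * seq (N + T)))
  : dtree N T -> Prop :=
  | VT_leaf a : valid_tree P (DLeaf N a)
  | VT_node A ts :
      ts <> [::] ->
      (forall t, List.In t ts -> t <> DEps) ->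
      (forall t, List.In t ts -> valid_tree P t) ->
      (A, flatten (map (@root_sym N T) ts)) \in P ->
      valid_tree P (DNode A ts)
  | VT_eps A : (A, [::]) \in P -> valid_tree P (DNode A [:: DEps]).

Fixpoint level (N T : Type) (j : nat) (t : dtree N T) : seq (N + T) :=
  match j, t with
  | 0, _ => root_sym t
  | j'.+1, DNode _ ts => flatten (map (level j') ts)
  | _.+1, _ => [::]
  end.

Fixpoint height (N T : Type) (t : dtree N T) : nat :=
  match t with
  | DNode _ ts => (foldr maxn 0 (map (@height N T) ts)).+1
  | _ => 0
  end.

Fixpoint yield (N T : Type) (t : dtree N T) : seq T :=
  match t with
  | DLeaf a => [:: a]
  | DEps => [::]
  | DNode _ ts => flatten (map (@yield N T) ts)
  end.

Record tc_grammar (N T : finType) := TCGrammar {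
  tc_rules : seq (N * seq (N + T));
  tc_start : N;
  tc_control : seq (N + T) -> Prop
}.

Definition tc_wellformed (N T : finType) (G : tc_grammar N T) : Prop :=
  forall r, r \in tc_rules G -> r.2 = [::] ->
    r.1 = tc_start G /\ forall r', r' \in tc_rules G -> inl (tc_start G) \notin r'.2.

Definition tc_lang (N T : finType) (G : tc_grammar N T) (z : seq T) : Prop :=
  exists t : dtree N T,
    [/\ valid_tree (tc_rules G) t,
        root_sym t = [:: inl (tc_start G)],
        yield t = z &
        forall j, j < height t -> tc_control G (level j t)].

Definition in_TC_UF (T : finType) (L : seq T -> Prop) : Prop :=
  exists (N : finType) (G : tc_grammar N T),
    [/\ tc_wellformed G, union_free (tc_control G) &
        forall z, L z <-> tc_lang G z].

(* a rule (u, A, v, w) stands for u A v -> u w v *)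
Record cs_grammar (N T : finType) := CSGrammar {
  cs_rules : seq (seq (N + T) * N * seq (N + T) * seq (N + T));
  cs_start : N
}.

Definition cs_rhs (N T : finType) (r : seq (N + T) * N * seq (N + T) * seq (N + T))
  : seq (N + T) :=
  let: (u, _, v, w) := r in u ++ w ++ v.

Definition cs_wellformed (N T : finType) (G : cs_grammar N T) : Prop :=
  forall r, r \in cs_rules G -> let: (u, A, v, w) := r in
    w = [::] ->
    [/\ u = [::], v = [::], A = cs_start G &
        forall r', r' \in cs_rules G -> inl (cs_start G) \notin cs_rhs r'].

Definition cs_step (N T : finType) (G : cs_grammar N T) (x y : seq (N + T)) : Prop :=
  exists (p q u v w : seq (N + T)) (A : N),
    [/\ (u, A, v, w) \in cs_rules G,
        x = p ++ u ++ [:: inl A] ++ v ++ q &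
        y = p ++ u ++ w ++ v ++ q].

Definition cs_lang (N T : finType) (G : cs_grammar N T) (z : seq T) : Prop :=
  clos_refl_trans _ (@cs_step N T G) [:: inl (cs_start G)] (map inr z).

Definition in_CS (T : finType) (L : seq T -> Prop) : Prop :=
  exists (N : finType) (G : cs_grammar N T),
    cs_wellformed G /\ forall z, L z <-> cs_lang G z.

(* Main.v *)
Require Import Defs.
From Stdlib Require Import Relations Classical.
From Stdlib Require List.
From mathcomp Require Import all_boot.
Set Implicit Arguments. Unset Strict Implicit. Unset Printing Implicit Defensive.

(** A derivation tree is a sequence of parallel rewriting steps on its levels, in which
    terminals of earlier levels are kept as inert items.

    TC(UF) is contained in CS: since no step shrinks the word, one head sweeping over it can
    rewrite a level while running a finite automaton for the control language on that level;
    the sweep uses rules [A -> w] and [A B -> C D] only, and each rule of the second kind is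
    split into four context-sensitive rules through a pair of markers.

    CS is contained in TC(UF): the star of a finite set of words is union-free. Take as
    these words all single plain symbols and, for each rule [u A v -> u w v], one block of
    marked symbols spelling [u A v]. Plain symbols may become marked at the next level; the
    control then forces marked symbols to form complete blocks, and a marked symbol is
    replaced by its image under the rule. Terminals occur in no control word, hence only
    in the last level. *)

Lemma finite_comprehension (X : eqType) (l : seq X) (P : X -> Prop) :
  exists l' : seq X, forall x, x \in l' <-> x \in l /\ P x.
Proof.
elim: l => [|a l [l' IH]]; first by exists [::] => x; split=> // -[].
case: (classic (P a)) => Pa.
  exists (a :: l') => x; rewrite !inE; split.
    by case/orP => [/eqP ->|/IH [xl Px]]; rewrite ?eqxx ?xl ?orbT.
  by case=> /orP [-> //|xl] Px; apply/orP; right; apply/IH.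
exists l' => x; rewrite inE; split=> [/IH [-> Px]|]; first by rewrite orbT.
by case=> /orP [/eqP -> //|xl] Px; apply/IH.
Qed.

Lemma bounded_words (X : finType) n :
  exists l : seq (seq X), forall w, size w <= n -> w \in l.
Proof.
elim: n => [|n [l IH]]; first by exists [:: [::]] => w; rewrite leqn0 => /nilP ->.
exists ([::] :: [seq x :: w | x <- enum X, w <- l]) => -[|x w] //= sw.
by rewrite inE; apply/allpairsP; exists (x, w); rewrite mem_enum IH.
Qed.

(** * Finite automata for union-free expressions *)

Section Paths.
Variables (V Q : Type) (st : Q -> option V -> Q -> Prop).

Inductive epath : Q -> seq V -> Q -> Prop :=
  | ep_nil q : epath q [::] q
  | ep_eps p q r w : st p None q -> epath q w r -> epath p w r
  | ep_sym p a q r w : st p (Some a) q -> epath q w r -> epath p (a :: w) r.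

Lemma epath_cat p u q v r : epath p u q -> epath q v r -> epath p (u ++ v) r.
Proof.
elim=> // [{}p p' {}q {}u H _ IH /IH|{}p a p' {}q {}u H _ IH /IH].
  exact: ep_eps H.
exact: ep_sym H.
Qed.

Lemma epath_split p u v r :
  epath p (u ++ v) r -> exists2 q, epath p u q & epath q v r.
Proof.
move: {2}(u ++ v) (erefl (u ++ v)) => w Ew; rewrite Ew => H.
elim: H u v Ew => {p w r} [q [|//] [|//] _|p q r w H Hw IH u v Ew|p a q r w H Hw IH].
- by exists q; constructor.
- by case: (IH u v Ew) => q' Hu Hv; exists q' => //; apply: ep_eps H _.
case=> [|b u] v /=.
  by move=> ->; exists p; [constructor | apply: ep_sym H _].
by case=> -> /IH [q' Hu Hv]; exists q' => //; apply: ep_sym H _.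
Qed.

End Paths.

Section Thompson.
Variable V : Type.

Inductive sym_step (a : V) : bool -> option V -> bool -> Prop :=
  | sym_step_intro : sym_step a false (Some a) true.

Inductive cat_step (Q1 Q2 : Type) (s1 : Q1 -> option V -> Q1 -> Prop)
    (s2 : Q2 -> option V -> Q2 -> Prop) (f1 : Q1) (i2 : Q2) :
    Q1 + Q2 -> option V -> Q1 + Q2 -> Prop :=
  | cat_step_l p o q : s1 p o q -> cat_step s1 s2 f1 i2 (inl p) o (inl q)
  | cat_step_m : cat_step s1 s2 f1 i2 (inl f1) None (inr i2)
  | cat_step_r p o q : s2 p o q -> cat_step s1 s2 f1 i2 (inr p) o (inr q).

Inductive star_step (Q : Type) (s : Q -> option V -> Q -> Prop) (i f : Q) :
    option Q -> option V -> option Q -> Prop :=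
  | star_step_in : star_step s i f None None (Some i)
  | star_step_out : star_step s i f (Some f) None None
  | star_step_mid p o q : s p o q -> star_step s i f (Some p) o (Some q).

Lemma epath_map (Q Q' : Type) (h : Q -> Q') s s' p w q :
  (forall p o q, s p o q -> s' (h p) o (h q)) ->
  @epath V Q s p w q -> @epath V Q' s' (h p) w (h q).
Proof.
move=> hs; elim=> [r|{}p r {}q {}w H _ IH|{}p a r {}q {}w H _ IH].
- by constructor.
- by apply: ep_eps IH; apply: hs.
by apply: ep_sym IH; apply: hs.
Qed.

Lemma epath_cat_step Q1 Q2 s1 s2 f1 i2 x w y :
  epath (@cat_step Q1 Q2 s1 s2 f1 i2) x w y ->
  match x, y with
  | inl p, inr r => exists u v, [/\ w = u ++ v, epath s1 p u f1 & epath s2 i2 v r]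
  | inr p, inr r => epath s2 p w r
  | _, _ => True
  end.
Proof.
elim=> {x w y} [[]// q|x y z w H _|x a y z w H _]; first by constructor.
  move: H; move Eo: None => o H.
  case: H Eo => [p [a|] q H||p [a|] q H] //; case: z => [z|z] // _.
  - by case=> u [v [-> Hu Hv]]; exists u, v; split=> //; apply: ep_eps H _.
  - by move=> Hw; exists [::], w; split=> //; constructor.
  exact: ep_eps H.
move: H; move Eo: (Some a) => o H.
case: H Eo => [p [b|] q H||p [b|] q H] //; case: z => [z|z] // [->].
  by case=> u [v [-> Hu Hv]]; exists (b :: u), v; split=> //; apply: ep_sym H _.
exact: ep_sym H.
Qed.

Lemma epath_star_step Q s i f e x w y :
  (forall u, epath s i u f -> uf_lang e u) ->
  epath (@star_step Q s i f) x w y ->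
  match x, y with
  | Some p, None => exists u v, [/\ w = u ++ v, epath s p u f & uf_lang (UF_star e) v]
  | None, None => uf_lang (UF_star e) w
  | _, _ => True
  end.
Proof.
move=> He; elim=> {x w y} [[]//|x y z w H _|x a y z w H _]; first by constructor.
  move: H; move Eo: None => o H.
  case: H Eo => [||p [a|] q H] //; case: z => [z|] // _.
  - by case=> u [v [-> Hu Hv]]; constructor=> //; apply: He.
  - by move=> Hw; exists [::], w; split=> //; constructor.
  by case=> u [v [-> Hu Hv]]; exists u, v; split=> //; apply: ep_eps H _.
move: H; move Eo: (Some a) => o H.
case: H Eo => [||p [b|] q H] //; case: z => [z|] // [->].
by case=> u [v [-> Hu Hv]]; exists (b :: u), v; split=> //; apply: ep_sym H _.
Qed.

Lemma uf_lang_epath (e : uf_expr V) :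
  exists (Q : finType) (s : Q -> option V -> Q -> Prop) (i f : Q),
  forall w, uf_lang e w <-> epath s i w f.
Proof.
elim: e => [|a|e1 [Q1 [s1 [i1 [f1 H1]]]] e2 [Q2 [s2 [i2 [f2 H2]]]]|e [Q [s [i [f He]]]]].
- exists bool, (fun _ _ _ => False), false, true => w; split=> H; first by inversion H.
  by inversion H.
- exists bool, (sym_step a), false, true => w; split=> H.
    by inversion H; apply: ep_sym (ep_nil _ _); constructor.
  inversion H as [|p q r w' S|p b q r w' S Hw]; subst; inversion S; subst.
  inversion Hw as [|p1 q1 r1 w1 S'|p2 b2 q2 r2 w2 S' Hw']; subst; first by constructor.
    by inversion S'.
  by inversion S'.
- exists (Q1 + Q2)%type, (cat_step s1 s2 f1 i2), (inl i1), (inr f2) => w; split.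
    move=> H; inversion H as [|e e' u v Hu Hv| |]; subst.
    apply: (@epath_cat _ _ _ _ _ (inl f1)).
      by apply: epath_map (proj1 (H1 _) Hu) => p o q; constructor.
    apply: ep_eps (cat_step_m _ _ _ _) _.
    by apply: epath_map (proj1 (H2 _) Hv) => p o q; constructor.
  by move=> /(@epath_cat_step _ _ _ _ _ _ (inl _) _ (inr _)) [u [v [-> /H1 Hu /H2 Hv]]]; constructor.
exists (option Q), (star_step s i f), None, None => w; split; last first.
  by apply: (@epath_star_step _ _ _ _ _ None _ None) => u /He.
move Ee: (UF_star e) => e' H.
elim: H Ee => // {e' w} [e'|e' u v Hu _ _ IH] Ee; first by constructor.
move: Hu (IH Ee); case: Ee => <- Hu Hv; apply: epath_cat Hv.
apply: ep_eps (star_step_in _ _ _) _; rewrite -[u]cats0.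
apply: (@epath_cat _ _ _ _ _ (Some f)).
  by apply: epath_map (proj1 (He _) Hu) => p o q; constructor.
by apply: ep_eps (star_step_out _ _ _) _; constructor.
Qed.

End Thompson.

(** * Trees as runs of parallel steps *)

Section Runs.
Variables (N T : eqType).

(* [inl a] is a terminal of an earlier level, [inr X] a symbol of the current level. *)
Definition item : Type := (T + (N + T))%type.

Definition active (c : seq item) : seq (N + T) :=
  pmap (fun i : item => if i is inr X then Some X else None) c.

Definition letter (i : item) : option T :=
  match i with inl a => Some a | inr (inr a) => Some a | inr (inl _) => None end.

Lemma active_cat c d : active (c ++ d) = active c ++ active d.
Proof. exact: pmap_cat. Qed.

Lemma active_map_inr x : active (map inr x) = x.
Proof. by elim: x => //= X x ->. Qed.

Section Steps.
Variable P : seq (N * seq (N + T)).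

Inductive istep : item -> seq item -> Prop :=
  | istep_old a : istep (inl a) [:: inl a]
  | istep_leaf a : istep (inr (inr a)) [:: inl a]
  | istep_node A w : (A, w) \in P -> istep (inr (inl A)) (map inr w).

Inductive cstep : seq item -> seq item -> Prop :=
  | cstep_nil : cstep [::] [::]
  | cstep_cons i w c d : istep i w -> cstep c d -> cstep (i :: c) (w ++ d).

Lemma cstep_cat c d c' d' : cstep c d -> cstep c' d' -> cstep (c ++ c') (d ++ d').
Proof.
by elim=> //= i w {}c {}d Hi _ IH /IH; rewrite -catA; apply: cstep_cons.
Qed.

Lemma cstep_item i w : istep i w -> cstep [:: i] w.
Proof. by move=> H; rewrite -[w]cats0; apply: cstep_cons => //; constructor. Qed.

Inductive run (R : seq (N + T) -> Prop) : seq item -> seq T -> Prop :=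
  | run_done c z : map letter c = map Some z -> run R c z
  | run_step c d z : R (active c) -> cstep c d -> run R d z -> run R c z.

End Steps.

Lemma run_mono P P' R c z : {subset P <= P'} -> run P R c z -> run P' R c z.
Proof.
move=> sP; elim=> [{}c {}z|{}c d {}z HR H _]; first exact: run_done.
apply: run_step => //; elim: H => [|i w c' d' Hi _]; first exact: cstep_nil.
apply: cstep_cons; case: Hi => [a|a|A {}w /sP]; [exact: istep_old|exact: istep_leaf|].
exact: istep_node.
Qed.

Definition flevel j (f : seq (T + dtree N T)) : seq (N + T) :=
  flatten [seq if i is inr t then level j t else [::] | i <- f].

Definition fheight (f : seq (T + dtree N T)) : nat :=
  foldr maxn 0 [seq if i is inr t then height t else 0 | i <- f].

Definition fyield (f : seq (T + dtree N T)) : seq T :=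
  flatten [seq match i with inl a => [:: a] | inr t => yield t end | i <- f].

Definition config (f : seq (T + dtree N T)) : seq item :=
  flatten [seq match i with inl a => [:: inl a] | inr t => map inr (root_sym t) end | i <- f].

Definition child (i : T + dtree N T) : seq (T + dtree N T) :=
  match i with
  | inl a => [:: inl a]
  | inr (DLeaf a) => [:: inl a]
  | inr DEps => [::]
  | inr (DNode _ ts) => flatten [seq if t is DEps then [::] else [:: inr t] | t <- ts]
  end.

Definition children f := flatten (map child f).

Definition valid_item P (i : T + dtree N T) :=
  match i with inl a => True | inr t => t <> DEps /\ valid_tree P t end.

Definition valid_forest P f := forall i, List.In i f -> valid_item P i.

Lemma valid_forest_cat P f g :
  valid_forest P (f ++ g) <-> valid_forest P f /\ valid_forest P g.
Proof.
split=> [H|[Hf Hg] i /(List.in_app_or f g i) [/Hf|/Hg] //].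
by split=> i Hi; apply: H; apply: (List.in_or_app f g i); [left|right].
Qed.

Lemma valid_forest_cons P i f :
  valid_forest P (i :: f) <-> valid_item P i /\ valid_forest P f.
Proof.
split=> [H|[Hi Hf] j [<-|/Hf] //].
by split=> [|j Hj]; apply: H; [left|right].
Qed.

Lemma fheight_cat f g : fheight (f ++ g) = maxn (fheight f) (fheight g).
Proof. by rewrite /fheight; elim: f => [|i f IH] /=; rewrite ?max0n // IH maxnA. Qed.

Lemma flevel_cat j f g : flevel j (f ++ g) = flevel j f ++ flevel j g.
Proof. by rewrite /flevel map_cat flatten_cat. Qed.

Lemma fyield_cat f g : fyield (f ++ g) = fyield f ++ fyield g.
Proof. by rewrite /fyield map_cat flatten_cat. Qed.

Lemma config_cat f g : config (f ++ g) = config f ++ config g.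
Proof. by rewrite /config map_cat flatten_cat. Qed.

Lemma children_cons i f : children (i :: f) = child i ++ children f.
Proof. by []. Qed.

Lemma flevel_child j i : flevel j (child i) = flevel j.+1 [:: i].
Proof.
case: i => [a|[a||A ts]] //; rewrite /flevel /= cats0.
elim: ts => //= t ts IH; rewrite map_cat flatten_cat IH.
by case: t => [a||B us] /=; rewrite ?cats0 //; case: j {IH}.
Qed.

Lemma flevel_children j f : flevel j (children f) = flevel j.+1 f.
Proof.
elim: f => // i f IH.
by rewrite children_cons flevel_cat IH -[i :: f]cat1s flevel_cat flevel_child.
Qed.

Lemma fyield_children f : fyield (children f) = fyield f.
Proof.
elim: f => // i f IH.
rewrite children_cons fyield_cat IH -[i :: f]cat1s fyield_cat; congr (_ ++ _).
case: i => [a|[a||A ts]] //; rewrite /fyield /= cats0.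
elim: ts => //= t ts IHt; rewrite map_cat flatten_cat IHt.
by case: t => //= *; rewrite cats0.
Qed.

Lemma fheight_children f : fheight (children f) = (fheight f).-1.
Proof.
have pred_maxn m n : (maxn m n).-1 = maxn m.-1 n.-1.
  by case: m n => [|m] [|n]; rewrite ?max0n ?maxn0 // maxnSS.
elim: f => // i f IH.
rewrite children_cons fheight_cat IH -[i :: f]cat1s fheight_cat pred_maxn; congr (maxn _ _).
case: i => [a|[a||A ts]] //; rewrite /fheight /=.
elim: ts => //= t ts IHt.
by rewrite -IHt; case: t => /=; rewrite ?max0n.
Qed.

Lemma active_config f : active (config f) = flevel 0 f.
Proof.
elim: f => // i f IH; rewrite -[i :: f]cat1s config_cat flevel_cat active_cat IH.
by congr (_ ++ _); case: i => [a|[a||A ts]].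
Qed.

Lemma valid_children P f : valid_forest P f -> valid_forest P (children f).
Proof.
elim: f => // i f IH /valid_forest_cons [Hi /IH Hf]; rewrite children_cons.
apply/valid_forest_cat; split=> //; case: i Hi => [a|[a||A ts]] /=.
- by move=> _ j [<-|].
- by move=> _ j [<-|].
- by case.
case=> _ H; inversion H as [|A' ts' _ Hne Hv _ |A' _]; subst; last by [].
elim: ts Hne Hv {H Hf IH} => [_ _ i []|t ts IH Hne Hv] /=.
apply/valid_forest_cat; split; last by apply: IH => u Hu; [apply: Hne|apply: Hv]; right.
have Ht := Hv t (or_introl erefl); have Ht' := Hne t (or_introl erefl).
by case: t Ht Ht' {Hne Hv IH} => // [a|B us] Ht Ht' j [<-|].
Qed.

Lemma cstep_children P f : valid_forest P f -> cstep P (config f) (config (children f)).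
Proof.
elim: f => [_|i f IH /valid_forest_cons [Hi /IH Hf]]; first exact: cstep_nil.
rewrite children_cons config_cat -[i :: f]cat1s config_cat; apply: cstep_cat Hf.
case: i Hi => [a|[a||A ts]] /=.
- by move=> _; apply: cstep_item; constructor.
- by move=> _; apply: cstep_item; constructor.
- by case.
case=> _ H; apply: cstep_item.
inversion H as [|A' ts' _ Hne Hv HP|A' HP]; subst; last exact: (istep_node HP).
have -> : config (flatten [seq if t is DEps then [::] else [:: inr t] | t <- ts])
  = map inr (flatten (map (@root_sym N T) ts)); last exact: istep_node.
elim: ts Hne {H Hv HP} => //= t ts IHt Hne; rewrite config_cat map_cat IHt.
  by case: t {Hne} => //= *; rewrite cats0.
by move=> u Hu; apply: Hne; right.
Qed.

Lemma run_of_forest P R f : valid_forest P f ->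
  (forall j, j < fheight f -> R (flevel j f)) -> run P R (config f) (fyield f).
Proof.
move: {2}(fheight f) (erefl (fheight f)) => k; elim: k f => [|k IH] f Ek Hf HR.
  apply: run_done; elim: f Ek Hf {HR} => //= i f IH Ek /valid_forest_cons [Hi Hf].
  move/eqP: Ek; rewrite -[i :: f]cat1s fheight_cat -leqn0 geq_max !leqn0.
  case/andP=> Ei /eqP Ef; rewrite config_cat fyield_cat !map_cat IH //; congr (_ ++ _).
  by case: i Hi Ei => [a|[a||A ts]] //= -[].
apply: (@run_step P R _ (config (children f))).
- by rewrite active_config; apply: HR; rewrite Ek.
- exact: cstep_children.
rewrite -fyield_children; apply: IH; rewrite ?fheight_children ?Ek //.
  exact: valid_children.
by move=> j Hj; rewrite flevel_children; apply: HR; rewrite Ek.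
Qed.

Lemma config_split P f c d : valid_forest P f -> config f = c ++ d ->
  exists f1 f2, [/\ f = f1 ++ f2, config f1 = c & config f2 = d].
Proof.
elim: f c => [|i f IH] c Hf.
  by case: c => //; case: d => // _; exists [::], [::].
case: c => [|j c] E; first by exists [::], (i :: f).
case/valid_forest_cons: Hf => Hi /IH {}IH.
move: E; rewrite -[i :: f]cat1s config_cat.
have [k Ek] : exists k, config [:: i] = [:: k].
  by case: i Hi => [a|[a||A ts]] //=; [exists (inl a)|exists (inr (inr a))|case|
    exists (inr (inl A))].
rewrite Ek => -[<- /IH [f1 [f2 [-> E1 E2]]]]; exists (i :: f1), f2; split=> //.
by rewrite -[i :: f1]cat1s config_cat Ek E1.
Qed.

Lemma config_map_inr P f w : valid_forest P f -> config f = map inr w ->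
  exists ts, [/\ f = map inr ts, flatten (map (@root_sym N T) ts) = w,
    forall t, List.In t ts -> t <> DEps & forall t, List.In t ts -> valid_tree P t].
Proof.
elim: f w => [|i f IH] w; first by case: w => // _ _; exists [::].
case/valid_forest_cons=> Hi /IH {}IH; rewrite -[i :: f]cat1s config_cat.
case: i Hi => [a|t [Ht Vt]]; first by case: w.
have [X EX] : exists X, root_sym t = [:: X] by case: t Ht {Vt} => [a||A ts] //=; eexists.
case: w => [|Y w]; rewrite /config /= EX //= => -[EY /IH [ts [-> <- Hn Hv]]].
exists (t :: ts); rewrite /= EX EY; split=> // u [<-|] //; [exact: Hn|exact: Hv].
Qed.

Lemma config_singleton_old P f a : valid_forest P f -> config f = [:: inl a] -> f = [:: inl a].
Proof.
case: f => // i f /valid_forest_cons [Hi Hf].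
have Ef : config f = [::] -> f = [::].
  by case: f Hf => // -[b|[b||B us]] f /valid_forest_cons [] // [].
by case: i Hi => [b|[b||B us]] //= => [_ [-> /Ef ->]|[]].
Qed.

Lemma forest_of_istep P i w f : istep P i w -> valid_forest P f -> config f = w ->
  exists i', [/\ valid_item P i', config [:: i'] = [:: i] & child i' = f].
Proof.
case=> [a|a|A {}w HA] Hf.
- by move/(config_singleton_old Hf)=> ->; exists (inl a).
- move/(config_singleton_old Hf)=> ->; exists (inr (DLeaf N a)); split=> //.
  by split=> //; constructor.
case/(config_map_inr Hf) => ts [-> Ew Hn Hv].
have [Ets|/eqP Ets] := eqVneq (size ts) 0.
  rewrite (size0nil Ets) in Ew *; subst w.
  by exists (inr (DNode A [:: DEps])); split=> //; split=> //; constructor.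
exists (inr (DNode A ts)); split=> //=.
  by split=> //; constructor; rewrite ?Ew // => E; rewrite E in Ets.
elim: ts Hn {Hf Ew Hv Ets} => //= t ts IH Hn; rewrite IH; last by move=> u Hu; apply: Hn; right.
by have := Hn t (or_introl erefl); case: t {Hn}.
Qed.

Lemma forest_of_cstep P c d f : cstep P c d -> valid_forest P f -> config f = d ->
  exists f', [/\ valid_forest P f', config f' = c & children f' = f].
Proof.
move=> H; elim: H f => [|i w {}c {}d Hi _ IH] f Hf.
  case: f Hf => [|i f] Hf; first by exists [::].
  by case/valid_forest_cons: Hf; case: i => [a|[a||A ts]] // [].
case/(config_split Hf) => f1 [f2 [Ef E1 E2]]; move: Hf; rewrite Ef.
case/valid_forest_cat=> Hf1 Hf2; have [f' [Hf' Ec <-]] := IH _ Hf2 E2.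
have [i' [Hi' Ei <-]] := forest_of_istep Hi Hf1 E1.
exists (i' :: f'); split=> //; first by apply/valid_forest_cons.
by rewrite -[i' :: f']cat1s config_cat Ei Ec.
Qed.

Lemma forest_of_run P R c z : run P R c z -> exists f, [/\ valid_forest P f,
  config f = c, fyield f = z & forall j, j < fheight f -> R (flevel j f)].
Proof.
elim=> [{}c {}z E|{}c d {}z HR Hs _ [f [Hf Ec <- Hj]]].
  have [f [Hf Ec Ey Eh]] : exists f, [/\ valid_forest P f, config f = c, fyield f = z
      & fheight f = 0].
    elim: c z E => [|i c IH] [|a z] //=; first by exists [::]; split=> // i [].
    case=> Ei /IH [f [Hf <- <- Eh]].
    case: i Ei => [b|[//|b]] [->]; [exists (inl a :: f)|exists (inr (DLeaf N a) :: f)].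
      by split; rewrite /fheight /= ?max0n //; apply/valid_forest_cons.
    split; rewrite /fheight /= ?max0n //; apply/valid_forest_cons; split=> //.
    by split=> //; constructor.
  by exists f; split=> // j; rewrite Eh.
have [g [Hg Eg Ef]] := forest_of_cstep Hs Hf Ec.
exists g; split=> //; first by rewrite -fyield_children Ef.
case=> [|j] Hjg; first by rewrite -active_config Eg.
by rewrite -flevel_children Ef; apply: Hj; rewrite -Ef fheight_children; case: (fheight g) Hjg.
Qed.

End Runs.

Lemma tc_lang_run (N T : finType) (G : tc_grammar N T) z :
  tc_lang G z <-> run (tc_rules G) (tc_control G) [:: inr (inl (tc_start G))] z.
Proof.
split=> [[t [Hv Er <- HR]]|/forest_of_run [f [Hf Ec <- HR]]].
  have Hf : valid_forest (tc_rules G) [:: inr t].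
    by move=> i [<-|[]]; split=> // E; rewrite E in Er.
  have := @run_of_forest _ _ _ (tc_control G) _ Hf; rewrite /config /fyield /= !cats0 Er; apply.
  by move=> j; rewrite /fheight /flevel /= maxn0 cats0; apply: HR.
have [ts [Ef Er Hn Hv]] := config_map_inr (w := [:: _]) Hf Ec.
case: ts Er Ef Hn Hv => // t ts.
case: ts => [|u ts].
  rewrite /= cats0 => Er Ef Hn Hv; exists t; rewrite Ef /fyield /= cats0; split=> //.
    by apply: Hv; left.
  by move=> j Hj; move: (HR j); rewrite Ef /fheight /flevel /= maxn0 cats0; apply.
move=> Er _ Hn _; have := Hn t (or_introl erefl); have := Hn u (or_intror (or_introl erefl)).
by move: Er; case: t {Hn} => [a||A us]; case: u => //= ? ? ? [].
Qed.

(** * Two-cell rewriting systems *)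

Lemma clos_rt_map (A B : Type) (R : A -> A -> Prop) (S : B -> B -> Prop) (f : A -> B) x y :
  (forall x y, R x y -> clos_refl_trans _ S (f x) (f y)) ->
  clos_refl_trans _ R x y -> clos_refl_trans _ S (f x) (f y).
Proof.
move=> H; elim=> [{}x {}y /H //|{}x|{}x {}y z _ IH1 _ IH2]; first exact: rt_refl.
exact: rt_trans IH1 IH2.
Qed.

Lemma cat_cons_eq_singleton (X : Type) (p u v q : seq X) a b :
  p ++ u ++ a :: v ++ q = [:: b] -> [/\ p = [::], u = [::], v = [::] & q = [::]].
Proof. by case: p => [|? []] //; case: u => [|? []] //; case: v => //; case: q. Qed.

Section TwoCell.
Variables (N T : finType).
Variables (rel1 : N -> seq (N + T) -> Prop) (rel2 : N -> N -> N + T -> N + T -> Prop).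
Variables (s : N) (E : Prop) (B : nat).
Hypothesis rel1_nonerasing : forall A w, rel1 A w -> w <> [::].
Hypothesis rel1_bounded : forall A w, rel1 A w -> size w <= B.

Inductive kstep : seq (N + T) -> seq (N + T) -> Prop :=
  | kstep1 p q A w : rel1 A w -> kstep (p ++ inl A :: q) (p ++ w ++ q)
  | kstep2 p q A A' C D : rel2 A A' C D ->
      kstep (p ++ inl A :: inl A' :: q) (p ++ C :: D :: q).

Definition rule2 : finType := (N * N * (N + T) * (N + T))%type.
(* [Some (inr (false, r))] and [Some (inr (true, r))] mark the left and the right cell of a
   pending application of the two-cell rule [r]; [None] is a fresh start symbol. *)
Definition M : finType := option (N + bool * rule2).
Definition csym : finType := (M + T)%type.

Definition cembed (X : N + T) : csym :=
  match X with inl A => inl (Some (inl A)) | inr a => inr a end.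
Definition pending (b : bool) (r : rule2) : M := Some (inr (b, r)).

Inductive crel : seq csym * M * seq csym * seq csym -> Prop :=
  | crel_start : crel ([::], None, [::], [:: cembed (inl s)])
  | crel_eps : E -> crel ([::], None, [::], [::])
  | crel_1 A w : rel1 A w -> crel ([::], Some (inl A), [::], map cembed w)
  | crel_2a A A' C D : rel2 A A' C D ->
      crel ([::], Some (inl A), [:: cembed (inl A')], [:: inl (pending false (A, A', C, D))])
  | crel_2b A A' C D : rel2 A A' C D ->
      crel ([:: inl (pending false (A, A', C, D))], Some (inl A'), [::],
            [:: inl (pending true (A, A', C, D))])
  | crel_2c A A' C D : rel2 A A' C D ->
      crel ([::], pending false (A, A', C, D), [:: inl (pending true (A, A', C, D))], [:: cembed C])
  | crel_2d A A' C D : rel2 A A' C D ->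
      crel ([:: cembed C], pending true (A, A', C, D), [::], [:: cembed D]).

Lemma crel_finite : exists l : seq (seq csym * M * seq csym * seq csym), forall r, r \in l <-> crel r.
Proof.
have [l Hl] := @bounded_words csym (maxn B 1).
have [l' Hl'] := finite_comprehension
  [seq (x, v.2) | x <- [seq (x, v.1) | x <- [seq (u, A) | u <- l, A <- enum M],
      v <- [seq (v, [::] : seq csym) | v <- l]],
     v <- [seq ([::] : seq csym, w) | w <- l]] crel.
exists l' => r; rewrite Hl'; split=> [[]//|H]; split=> //.
suff: [&& size r.1.1.1 <= maxn B 1, size r.1.2 <= maxn B 1 & size r.2 <= maxn B 1].
  case: r H => [[[u A] v] w] /= _ /and3P [/Hl Hu /Hl Hv /Hl Hw].
  apply/allpairsP; exists ((u, A, v), ([::], w)); split=> //=; last by apply/mapP; exists w.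
  apply/allpairsP; exists ((u, A), (v, [::])); split=> //=; last by apply/mapP; exists v.
  by apply/allpairsP; exists (u, A); rewrite /= mem_enum.
case: H => [|_|A w /rel1_bounded Hw||||] * //=; rewrite ?leq_max ?leqnn ?orbT //.
by rewrite size_map Hw.
Qed.

Definition decode1 (X : csym) (next : option csym) : N + T :=
  match X with
  | inl None => inl s
  | inl (Some (inl A)) => inl A
  | inl (Some (inr (false, r))) =>
      if next == Some (inl (pending true r)) then r.1.2 else inl r.1.1.1
  | inl (Some (inr (true, r))) => r.2
  | inr a => inr a
  end.

Definition lookahead (x : seq csym) (n : option csym) := if x is X :: _ then Some X else n.

(* Undoes or completes each pending two-cell rule: it counts as applied
   exactly when its right cell has been marked. *)
Fixpoint decode (x : seq csym) (n : option csym) : seq (N + T) :=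
  if x is X :: y then decode1 X (lookahead y n) :: decode y n else [::].

Definition right_mark (n : option csym) :=
  if n is Some (inl (Some (inr (true, _)))) then true else false.

Lemma decode_cat x y n : decode (x ++ y) n = decode x (lookahead y n) ++ decode y n.
Proof. by elim: x => //= X [|Y x] ->. Qed.

Lemma decode1_lookahead X n n' : ~~ right_mark n -> ~~ right_mark n' -> decode1 X n = decode1 X n'.
Proof.
case: X => [[[A|[[] r]]|]|a] //=.
by case: eqP => [->|_] //; case: eqP => [->|_].
Qed.

Lemma decode_lookahead x n n' : ~~ right_mark n -> ~~ right_mark n' -> decode x n = decode x n'.
Proof.
move=> Hn Hn'; elim: x => //= X y ->; congr cons.
by case: y => //=; apply: decode1_lookahead.
Qed.

Lemma decode_emb w n : decode (map cembed w) n = w.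
Proof. by elim: w => //= -[A|a] w ->. Qed.

Lemma decode1_emb X n : decode1 (cembed X) n = X.
Proof. by case: X. Qed.

Lemma right_mark_emb X : right_mark (Some (cembed X)) = false.
Proof. by case: X. Qed.

Lemma decode_step u A v w p q : crel (u, A, v, w) -> w <> [::] ->
  let x := p ++ u ++ inl A :: v ++ q in let y := p ++ u ++ w ++ v ++ q in
  clos_refl_trans _ kstep (decode x None) (decode y None).
Proof.
move=> H w0 /=; have eq_rt (a b : seq (N + T)) : a = b -> clos_refl_trans _ kstep a b.
  by move=> ->; apply: rt_refl.
move Er : (u, A, v, w) H => r H.
case: H Er => [|HE|A' z Hz|A1 A2 C D H|A1 A2 C D H|A1 A2 C D H|A1 A2 C D H] [Eu EA Ev Ew];
  subst => //=; rewrite !decode_cat //=.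
- by apply: eq_rt; congr (_ ++ _); apply: decode_lookahead.
- rewrite decode_emb; case: z Hz {w0} => [/rel1_nonerasing //|Z z] Hz.
  rewrite /= (@decode_lookahead p (Some (cembed Z)) (Some (inl (Some (inl A'))))) ?right_mark_emb //.
  exact: rt_step (kstep1 _ _ Hz).
- by apply: eq_rt; rewrite !(@decode_lookahead p (Some _) None) //.
- rewrite eqxx /=; apply/rt_step; exact: kstep2.
- apply: eq_rt; rewrite eqxx decode1_emb; congr (_ ++ _).
  by apply: decode_lookahead; rewrite ?right_mark_emb.
by apply: eq_rt; rewrite !decode1_emb.
Qed.

Lemma cs_of_two_cell_system :
  exists (N' : finType) (G : cs_grammar N' T), cs_wellformed G /\
  forall z, cs_lang G z <->
    clos_refl_trans _ kstep [:: inl s] (map inr z) \/ z = [::] /\ E.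
Proof.
have [l Hl] := crel_finite; exists M, (CSGrammar l None).
have noNone r : r \in l -> inl None \notin cs_rhs r.
  move/Hl => [|HE|A w _|A A' C D _|A A' C D _|A A' C D _|A A' C D _] //=;
    rewrite ?inE ?cats0 //.
  - by apply/negP => /mapP [[]].
  - by case: C.
  - by case: C; case: D.
split.
  move=> [[[u A] v] w] /Hl H w0; move: H; rewrite w0; move Er: (u, A, v, _) => r H.
  case: H Er => [|HE|A' z /rel1_nonerasing Hz|A1 A2 C D H|A1 A2 C D H|A1 A2 C D H|
     A1 A2 C D H] [] // -> -> -> // Ez.
  by case: z Hz Ez.
move=> z; split.
  rewrite /cs_lang /=; set x0 : seq csym := [:: _]; set y : seq csym := map _ z => H.
  have: [\/ y = x0, inl None \notin y /\ clos_refl_trans _ kstep [:: inl s] (decode y None)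
        | y = [::] /\ E].
    elim/clos_refl_trans_ind_left: H => [|x {}y _ IH [p [q [u [v [w [A [Hr Ex Ey]]]]]]]].
      by constructor 1.
    move: (noNone _ Hr); rewrite /cs_rhs => Hn; move/Hl: Hr => Hr.
    have Ex' : x = p ++ u ++ inl A :: v ++ q by rewrite Ex.
    case: (w =P [::]) => [w0|/eqP/eqP w0].
      case: IH => [|[Nx _]|[]].
      + subst w; move Er: (u, A, v, [::]) Hr => r Hr.
        case: Hr Er => [|HE|A' t /rel1_nonerasing Ht|A1 A2 C D H|A1 A2 C D H|A1 A2 C D H|
          A1 A2 C D H] [] // Eu EA Ev; last by case: t Ht.
        move=> Exx; constructor 3; split=> //; move: Exx; rewrite Ex' Ey.
        by move/(@cat_cons_eq_singleton csym) => [] -> -> -> ->.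
      + move: Hr Nx; rewrite Ex w0; move Er: (u, A, v, [::]) => r Hr.
        case: Hr Er => [|HE|A' t /rel1_nonerasing Ht|A1 A2 C D H|A1 A2 C D H|A1 A2 C D H|
          A1 A2 C D H] [] // Eu EA Ev; last by case: t Ht.
        by rewrite EA !mem_cat inE eqxx !orbT.
      by rewrite Ex; case: p {Ex Ex' Ey} => // ; case: u {Hr Hn}.
    constructor 2.
    have Hs := decode_step p q Hr w0; rewrite /= -Ey in Hs.
    rewrite -Ex' in Hs.
    case: IH => [Exx|[Nx D]|[Exx _]]; last by move: Ex; rewrite Exx; case: p {Ey Hs Ex'} => //; case: u {Hn Hr}.
      split; last by move: Hs; rewrite Exx.
      move: Exx Hn; rewrite Ex' Ey => /(@cat_cons_eq_singleton csym) [-> -> -> ->].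
      by rewrite !cats0.
    split; last exact: rt_trans D Hs.
    move: Nx Hn; rewrite Ex Ey !mem_cat inE !negb_or.
    by do ![case/andP => ? | move=> ?]; do ![apply/andP; split].
  case=> [|[_]|[]]; first by rewrite /y; case: z {y H}.
    have -> : y = map cembed (map inr z) by rewrite -map_comp.
    by rewrite decode_emb; left.
  by rewrite /y; case: z {y H} => // _; right.
case=> [H|[-> HE]]; last first.
  apply: rt_step; exists [::], [::], [::], [::], [::], None; split=> //.
  by apply/Hl; constructor.
apply: (@rt_trans _ _ _ [:: cembed (inl s)]).
  apply: rt_step; exists [::], [::], [::], [::], [:: cembed (inl s)], None; split=> //.
  by apply/Hl; constructor.
have -> : map inr z = map cembed (map inr z) by rewrite -map_comp.
apply: (clos_rt_map (f := map cembed)) H => x y [p q A w H|p q A A' C D H].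
  rewrite !map_cat; apply: rt_step.
  exists (map cembed p), (map cembed q), [::], [::], (map cembed w), (Some (inl A)); split=> //.
  by apply/Hl; constructor.
rewrite !map_cat /=; set r := (A, A', C, D); set p' := map cembed p; set q' := map cembed q.
apply: (@rt_trans _ _ _ (p' ++ inl (pending false r) :: cembed (inl A') :: q')).
  apply: rt_step; exists p', q', [::], [:: cembed (inl A')], [:: inl (pending false r)], (Some (inl A)).
  by split=> //; apply/Hl; constructor.
apply: (@rt_trans _ _ _ (p' ++ inl (pending false r) :: inl (pending true r) :: q')).
  apply: rt_step; exists p', q', [:: inl (pending false r)], [::], [:: inl (pending true r)], (Some (inl A')).
  by split=> //; apply/Hl; constructor.
apply: (@rt_trans _ _ _ (p' ++ cembed C :: inl (pending true r) :: q')); apply: rt_step.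
  exists p', q', [::], [:: inl (pending true r)], [:: cembed C], (pending false r).
  by split=> //; apply/Hl; constructor.
exists p', q', [:: cembed C], [::], [:: cembed D], (pending true r).
by split=> //; apply/Hl; constructor.
Qed.

End TwoCell.

(** * From tree-controlled to context-sensitive grammars *)

Lemma marked_split (X : Type) (h : pred X) p x q p' x' q' :
  ~~ has h p -> ~~ has h q -> h x' -> p ++ x :: q = p' ++ x' :: q' ->
  [/\ p = p', x = x' & q = q'].
Proof.
elim: p p' => [|a p IH] [|b p'] /=.
- by move=> _ _ _ [-> ->].
- move=> _ Hq Hx [_ Eq]; move: Hq; rewrite Eq has_cat /= Hx orbT //.
- by rewrite negb_or => /andP [Ha _] _ Hx [Eab]; move: Ha; rewrite Eab Hx.
by rewrite negb_or => /andP [_ Hp] Hq Hx [-> /(IH _ Hp Hq Hx) [-> -> ->]].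
Qed.

Section Sweep.
Variables (N T : finType) (P : seq (N * seq (N + T))) (S : N).
Variables (Q : finType) (st : Q -> option (N + T) -> Q -> Prop) (i f : Q).
Hypothesis P_nonerasing : forall A w, (A, w) \in P -> w <> [::].

Definition R w := epath st i w f.
Definition ritem : finType := (T + (N + T))%type.

(* A cell carries two flags telling whether it is the first and whether it is the last. *)
Definition cell : finType := (bool * bool * ritem)%type.

(* The head is on an item to be rewritten ([Sweep]), on the last item
   of a rewritten block ([Done]), moving back to the left end ([Ret]),
   or printing the terminals ([Fin]). *)
Definition head : finType := (Q + Q + bool)%type.
Definition Sweep q : head := inl (inl q).
Definition Done q : head := inl (inr q).
Definition Ret : head := inr false.
Definition Fin : head := inr true.

Definition tsym : finType := (cell * option head)%type.

Definition mkl (b : bool) (c : seq ritem) : seq cell :=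
  if c is s :: c' then (b, false, s) :: map (fun s => (false, false, s)) c' else [::].

Fixpoint mkr (c : seq ritem) : seq cell :=
  if c is s :: c' then (false, nilp c', s) :: mkr c' else [::].

Definition plain (c : seq cell) : seq (tsym + T) := map (fun x => inl (x, None)) c.

Definition form (p : seq (tsym + T)) (b : bool) (s : ritem) (h : head) (c : seq ritem) :
    seq (tsym + T) :=
  p ++ inl ((b, nilp c, s), Some h) :: plain (mkr c).

Inductive trel1 : tsym -> seq (tsym + T) -> Prop :=
  | trel_rewrite l r s q w s' q' : istep P s (rcons w s') -> epath st q (active [:: s : item N T]) q' ->
      trel1 ((l, r, s), Some (Sweep q))
        (rcons (plain (mkl l w)) (inl ((l && nilp w, r, s'), Some (Done q'))))
  | trel_accept l s : trel1 ((l, true, s), Some (Done f)) [:: inl ((l, true, s), Some Ret)]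
  | trel_again r s : trel1 ((true, r, s), Some Ret) [:: inl ((true, r, s), Some (Sweep i))]
  | trel_print r s : trel1 ((true, r, s), Some Ret) [:: inl ((true, r, s), Some Fin)]
  | trel_end l s a : letter s = Some a -> trel1 ((l, true, s), Some Fin) [:: inr a].

Inductive trel2 : tsym -> tsym -> tsym + T -> tsym + T -> Prop :=
  | trel_right x y q : trel2 (x, Some (Done q)) (y, None) (inl (x, None)) (inl (y, Some (Sweep q)))
  | trel_left x y : trel2 (y, None) (x, Some Ret) (inl (y, Some Ret)) (inl (x, None))
  | trel_next l r s y a : letter s = Some a ->
      trel2 ((l, r, s), Some Fin) (y, None) (inr a) (inl (y, Some Fin)).

Definition sweep_step := kstep trel1 trel2.
Notation "x =>* y" := (clos_refl_trans _ sweep_step x y) (at level 70).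

Lemma istep_nonerasing s w : istep P s w -> w <> [::].
Proof. by case=> // A {}w /P_nonerasing; case: w. Qed.

Lemma trel1_nonerasing A w : trel1 A w -> w <> [::].
Proof. by case=> // l r s q {}w *; case: (plain _). Qed.

Lemma size_mkl b c : size (mkl b c) = size c.
Proof. by case: c => //= s c; rewrite size_map. Qed.

Lemma trel1_bounded : exists B, forall A w, trel1 A w -> size w <= B.
Proof.
exists (maxn 1 (\max_(r <- P) size r.2)) => A w; case=> [l r s q {}w s' q' H _||||] *;
  rewrite ?leq_max //=.
rewrite size_rcons size_map size_mkl -(size_rcons w s').
move Ew : (rcons w s') H => w' H; case: H => // B v HB; rewrite size_map.
by apply/orP; right; rewrite (big_rem _ HB) /= leq_maxl.
Qed.

Definition headed (X : tsym + T) : bool := if X is inl (_, Some _) then true else false.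

Lemma plain_unheaded c : has headed (plain c) = false.
Proof. by elim: c. Qed.

Lemma form_split p b s h c p' x q' : ~~ has headed p -> headed x ->
  form p b s h c = p' ++ x :: q' ->
  [/\ p = p', inl (b, nilp c, s, Some h) = x & plain (mkr c) = q'].
Proof. by move=> Hp Hx; apply: (@marked_split _ headed) => //; rewrite plain_unheaded. Qed.

Lemma mkl_cat b c d : mkl b (c ++ d) = mkl b c ++ mkl (b && nilp c) d.
Proof.
case: c => [|s c] /=; first by rewrite andbT.
by rewrite andbF map_cat; case: d.
Qed.

Lemma mkl_rcons b c s : mkl b (rcons c s) = rcons (mkl b c) (b && nilp c, false, s).
Proof. by rewrite -cats1 mkl_cat cats1. Qed.

Lemma plain_cat c d : plain (c ++ d) = plain c ++ plain d.
Proof. exact: map_cat. Qed.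

Definition reach c := forall z, run P R c z -> run P R [:: inr (inl S)] z.

Lemma reach_step c d : reach c -> R (active c) -> cstep P c d -> reach d.
Proof. by move=> Hc HR Hs z Hz; apply: Hc; apply: run_step Hs Hz. Qed.

Inductive sweep_inv : seq (tsym + T) -> Prop :=
  | inv_sweep c1 s c2 d1 q : reach (c1 ++ s :: c2) -> cstep P c1 d1 ->
      epath st i (active c1) q ->
      sweep_inv (form (plain (mkl true d1)) (nilp d1) s (Sweep q) c2)
  | inv_done c1 c2 d1 s q : reach (c1 ++ c2) -> cstep P c1 (rcons d1 s) ->
      epath st i (active c1) q ->
      sweep_inv (form (plain (mkl true d1)) (nilp d1) s (Done q) c2)
  | inv_ret c1 s c2 : reach (c1 ++ s :: c2) ->
      sweep_inv (form (plain (mkl true c1)) (nilp c1) s Ret c2)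
  | inv_fin c1 s c2 z b : reach (c1 ++ s :: c2) -> map (@letter N T) c1 = map Some z ->
      sweep_inv (form (map inr z) b s Fin c2)
  | inv_end c z : reach c -> map (@letter N T) c = map Some z -> sweep_inv (map inr z).

Lemma terminals_unheaded z : has headed (map (@inr tsym T) z) = false.
Proof. by elim: z. Qed.

Lemma terminals_split z p (A : tsym) q : map (@inr tsym T) z = p ++ inl A :: q -> False.
Proof. by elim: z p => [|a z IH] [|b p] //= [_ /IH]. Qed.

Lemma trel1_headed A w : trel1 A w -> headed (inl A).
Proof. by case. Qed.

Lemma sweep_terminals z y : ~ sweep_step (map inr z) y.
Proof.
by move Ex: (map _ z) => x H; case: H Ex => [p q A w _|p q A A' C D _] /terminals_split.
Qed.

Lemma sweep_form p b s h c y : ~~ has headed p -> sweep_step (form p b s h c) y ->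
  [\/ exists2 w, trel1 (b, nilp c, s, Some h) w & y = p ++ w ++ plain (mkr c),
      exists s2 c' C D, [/\ c = s2 :: c',
        trel2 (b, nilp c, s, Some h) (false, nilp c', s2, None) C D &
        y = p ++ C :: D :: plain (mkr c')] |
      exists p' z, [/\ p = rcons p' (inl (z, None)), h = Ret &
        y = p' ++ inl (z, Some Ret) :: inl (b, nilp c, s, None) :: plain (mkr c)]].
Proof.
move=> Hp; move Ex: (form p b s h c) => x H; case: H Ex => [p' q A w HA|p' q A A' C D HA].
  case/(form_split Hp (trel1_headed HA)) => -> [EA] ->; rewrite -EA in HA.
  by constructor 1; exists w.
have HA' := HA; move=> Ex; case: HA' HA Ex => [x1 y1 q1|x1 y1|l r s1 y1 a Ha] HA Ex.
- case: (form_split (x := inl (x1, Some (Done q1))) Hp isT Ex) => -> [Ex1 Eh] Eq.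
  constructor 2; case: c Ex HA Ex1 Eq => [|s2 c'] // Ex HA Ex1 [Ey1 Eq].
  by exists s2, c', (inl (x1, None)), (inl (y1, Some (Sweep q1))); rewrite Ex1 Eh Ey1 Eq.
- rewrite -cat_rcons in Ex.
  case: (form_split (x := inl (x1, Some Ret)) Hp isT Ex) => -> [<- ->] <-.
  by constructor 3; exists p', y1.
case: (form_split (x := inl (l, r, s1, Some Fin)) Hp isT Ex) => -> [El Er Es Eh] Eq.
constructor 2; case: c Ex HA Er Eq => [|s2 c'] // Ex HA Er [Ey1 Eq].
by exists s2, c', (inr a), (inl (y1, Some Fin)); rewrite El Er Es Eh Ey1 Eq.
Qed.

Lemma plain_rcons c x : plain (rcons c x) = rcons (plain c) (inl (x, None)).
Proof. exact: map_rcons. Qed.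

Lemma sweep_inv_step x y : sweep_inv x -> sweep_step x y -> sweep_inv y.
Proof.
have Hp c : ~~ has headed (plain c) by rewrite plain_unheaded.
have Hp' z : ~~ has headed (map (@inr tsym T) z) by rewrite terminals_unheaded.
case=> [c1 s c2 d1 q Hr Hs Hq|c1 c2 d1 s q Hr Hs Hq|c1 s c2 Hr|c1 s c2 z b Hr Hz|c z Hr Hz].
- case/(sweep_form (Hp _)) => [[w Hw ->]|[s2 [c' [C [D [Ec Hw Ey]]]]]|[p' [z [_ //]]]]; last by inversion Hw.
  inversion Hw as [l r s1 q1 v s' q' Hi Hq'| | | |]; subst.
  have -> : plain (mkl true d1) ++ rcons (plain (mkl (nilp d1) v))
       (inl (nilp d1 && nilp v, nilp c2, s', Some (Done q'))) ++ plain (mkr c2) =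
     form (plain (mkl true (d1 ++ v))) (nilp (d1 ++ v)) s' (Done q') c2.
    by rewrite /form mkl_cat plain_cat -catA cat_rcons cat_nilp.
  apply: (@inv_done (rcons c1 s)); first by rewrite cat_rcons.
    by rewrite -cats1 rcons_cat; apply: cstep_cat Hs _; apply: cstep_item.
  by rewrite -cats1 active_cat; apply: epath_cat Hq _.
- case/(sweep_form (Hp _)) => [[w Hw ->]|[s2 [c' [C [D [Ec Hw Ey]]]]]|[p' [z [_ //]]]].
    inversion Hw as [|l s1 K1 K2| | |]; subst.
    have /nilP Ec : nilp c2 = true by [].
    rewrite {}Ec cats0 /= in Hr *.
    apply: (inv_ret (c1 := d1) (s := s) (c2 := [::])).
    by rewrite cats1; apply: reach_step Hr _ Hs.
  inversion Hw; subst.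
  have -> : plain (mkl true d1) ++
       [:: inl (nilp d1, false, s, None), inl (false, nilp c', s2, Some (Sweep q)) & plain (mkr c')] =
     form (plain (mkl true (rcons d1 s))) (nilp (rcons d1 s)) s2 (Sweep q) c'.
    rewrite /form mkl_rcons plain_rcons cat_rcons.
    by case: d1 {Hs Hw}.
  exact: inv_sweep Hr Hs Hq.
- case/(sweep_form (Hp _)) => [[w Hw ->]|[s2 [c' [C [D [Ec Hw Ey]]]]]|[p' [z [Ec1 _ ->]]]].
  + inversion Hw as [| |r s1 K1 K2|r s1 K1 K2|]; subst;
      have /nilP Ec : nilp c1 = true by [].
      by rewrite Ec in Hr *; apply: (@inv_sweep [::] _ _ [::]) => //; constructor.
    by rewrite Ec in Hr *; apply: (@inv_fin [::] _ _ [::]).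
  + by inversion Hw.
  case/lastP: c1 Hr Ec1 => [|c1 s1] Hr; first by case: p'.
  rewrite mkl_rcons plain_rcons => /rcons_inj [<- <-].
  have -> : plain (mkl true c1) ++
     [:: inl (nilp c1, false, s1, Some Ret), inl (nilp (rcons c1 s1), nilp c2, s, None) & plain (mkr c2)]
     = form (plain (mkl true c1)) (nilp c1) s1 Ret (s :: c2).
    by rewrite /form; case: c1 {Hr}.
  by apply: inv_ret; rewrite cat_rcons in Hr.
- case/(sweep_form (Hp' _)) => [[w Hw ->]|[s2 [c' [C [D [Ec Hw Ey]]]]]|[p' [z' [_ //]]]].
    inversion Hw as [| | | |l s1 a Ha K1 K2]; subst.
    have /nilP Ec : nilp c2 = true by [].
    rewrite {}Ec in Hr *; rewrite -(map_cat _ z [:: a]) cats1; apply: (inv_end Hr).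
    by rewrite cats1 !map_rcons Hz Ha.
  inversion Hw as [| |l r s1 y1 a Ha K1]; subst.
  have -> : map (@inr tsym T) z ++ [:: inr a, inl (false, nilp c', s2, Some Fin) & plain (mkr c')] =
    form (map (@inr tsym T) (rcons z a)) false s2 Fin c'.
    by rewrite /form map_rcons cat_rcons.
  apply: (@inv_fin (rcons c1 s)); first by rewrite cat_rcons.
  by rewrite !map_rcons Hz Ha.
by move/sweep_terminals.
Qed.

Definition start : tsym := ((true, true, inr (inl S)), Some Ret).

Lemma run_of_kst z : [:: inl start] =>* map inr z -> run P R [:: inr (inl S)] z.
Proof.
have H0 : sweep_inv [:: inl start] by apply: (@inv_ret [::] _ [::]).
set x := map _ z => H; have : sweep_inv x.
  elim/clos_refl_trans_ind_left: H => // y y' _; exact: sweep_inv_step.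
move Ex: x => y Hy; case: Hy Ex; rewrite /x.
- by move=> c1 s c2 d1 q _ _ _ /terminals_split.
- by move=> c1 c2 d1 s q _ _ _ /terminals_split.
- by move=> c1 s c2 _ /terminals_split.
- by move=> c1 s c2 z' b _ _ /terminals_split.
move=> c z' Hr Hz E; apply: Hr; apply: run_done; rewrite Hz.
by congr map; apply: esym; apply: (inj_map _ E) => a b [].
Qed.

Lemma sweep_step1 p A w q : trel1 A w -> p ++ inl A :: q =>* p ++ w ++ q.
Proof. by move=> H; apply: rt_step; apply: kstep1. Qed.

Lemma sweep_step2 p A A' C D q : trel2 A A' C D ->
  p ++ inl A :: inl A' :: q =>* p ++ C :: D :: q.
Proof. by move=> H; apply: rt_step; apply: kstep2. Qed.

Lemma sweep_print s c2 z1 z2 b : map (@letter N T) (s :: c2) = map Some z2 ->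
  form (map inr z1) b s Fin c2 =>* map inr (z1 ++ z2).
Proof.
elim: c2 s z1 z2 b => [|s2 c2 IH] s z1 [|a z2] b //= [Ha Hz].
  case: z2 Hz => // _; rewrite map_cat.
  exact: (sweep_step1 _ [::] (trel_end _ Ha)).
apply: (rt_trans _ _ _ (form (map inr (rcons z1 a)) false s2 Fin c2)); last first.
  by rewrite -cat_rcons; apply: IH.
rewrite /form map_rcons cat_rcons; apply: sweep_step2; exact: trel_next.
Qed.

Lemma sweep_return c1 s c2 s' c : c1 ++ s :: c2 = s' :: c ->
  form (plain (mkl true c1)) (nilp c1) s Ret c2 =>* form [::] true s' Ret c.
Proof.
elim/last_ind: c1 s c2 => [|c1 s1 IH] s c2; first by case=> -> ->; exact: rt_refl.
rewrite cat_rcons => /IH; apply: rt_trans.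
rewrite /form mkl_rcons plain_rcons cat_rcons.
have -> : nilp (rcons c1 s1) = false by case: c1 {IH}.
exact: sweep_step2 (trel_left _ _).
Qed.

Lemma sweep_rewrite d1 s c2 q w s' q' : istep P s (rcons w s') ->
  epath st q (active [:: s : item N T]) q' ->
  form (plain (mkl true d1)) (nilp d1) s (Sweep q) c2 =>*
  form (plain (mkl true (d1 ++ w))) (nilp (d1 ++ w)) s' (Done q') c2.
Proof.
move=> Hi Hq; rewrite /form mkl_cat plain_cat cat_nilp -catA -[plain (mkl _ w) ++ _]cat_rcons.
by apply: sweep_step1; apply: trel_rewrite.
Qed.

Lemma sweep_sweep s c2 e d1 q r : cstep P (s :: c2) e ->
  epath st q (active (s :: c2 : seq (item N T))) r ->
  exists d s', d1 ++ e = rcons d s' /\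
  form (plain (mkl true d1)) (nilp d1) s (Sweep q) c2 =>*
  form (plain (mkl true d)) (nilp d) s' (Done r) [::].
Proof.
elim: c2 s e d1 q => [|s2 c2 IH] s e d1 q H; inversion H as [|s0 w c0 d0 Hi Hc]; subst;
  rewrite -[s :: _]cat1s active_cat; case/lastP: w Hi H => [/istep_nonerasing //|w s'] Hi H.
  inversion Hc; subst; rewrite !cats0 => Hq; exists (d1 ++ w), s'.
  by rewrite rcons_cat; split=> //; apply: sweep_rewrite.
case/(@epath_split _ _ st) => q' Hq Hq'.
have [d [s3 [Ed Hd]]] := IH _ _ (d1 ++ rcons w s') _ Hc Hq'.
exists d, s3; split; first by rewrite catA.
apply: rt_trans (sweep_rewrite _ _ Hi Hq) _; apply: rt_trans Hd.
rewrite -rcons_cat /form mkl_rcons plain_rcons cat_rcons.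
have -> : nilp (rcons (d1 ++ w) s') = false by case: (d1 ++ w).
exact: sweep_step2 (trel_right _ _ _).
Qed.

Lemma sweep_of_run c z : run P R c z ->
  if c is s :: c' then form [::] true s Ret c' =>* map inr z else True.
Proof.
elim=> [{}c {}z|{}c d {}z].
  case: c => // s c Hz; apply: (rt_trans _ _ _ (form [::] true s Fin c)).
    exact: (sweep_step1 [::] _ (trel_print _ _)).
  exact: (sweep_print [::]).
case: c => // s c HR Hs _ IH.
have [d' [s' [Ed Hd]]] := sweep_sweep [::] Hs HR; rewrite /= in Ed; subst d.
apply: (rt_trans _ _ _ (form [::] true s (Sweep i) c)).
  exact: (sweep_step1 [::] _ (trel_again _ _)).
apply: rt_trans Hd _; apply: (rt_trans _ _ _ (form (plain (mkl true d')) (nilp d') s' Ret [::])).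
  exact: (sweep_step1 _ [::] (trel_accept _ _)).
case E: (rcons d' s') IH => [|s1 c1]; first by case: (d') E.
by apply: rt_trans; apply: sweep_return; rewrite cats1.
Qed.

Lemma sweep_iff_run z : [:: inl start] =>* map inr z <-> run P R [:: inr (inl S)] z.
Proof. by split; [exact: run_of_kst | exact: (@sweep_of_run [:: _])]. Qed.

End Sweep.

Lemma run_nil (N T : eqType) (P : seq (N * seq (N + T))) R z : run P R [::] z -> z = [::].
Proof.
move Ec: (@nil (item N T)) => c H; elim: H Ec => [{}c {}z Hz|{}c d {}z _ Hs _ IH] Ec; subst.
  by case: z Hz.
by apply: IH; inversion Hs.
Qed.

Lemma run_nonerasing (N T : finType) (G : tc_grammar N T) z :
  tc_wellformed G -> z <> [::] ->
  run (tc_rules G) (tc_control G) [:: inr (inl (tc_start G))] z ->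
  run [seq r <- tc_rules G | r.2 != [::]] (tc_control G) [:: inr (inl (tc_start G))] z.
Proof.
move=> Gw z0; set P := tc_rules G; set P' := filter _ _; set S := tc_start G; set R := tc_control G.
have H c : (exists A, (A, [::]) \in P) -> inr (inl S) \notin c -> run P R c z -> run P' R c z.
  move=> [A HA] Hc H; have [EA HS] := Gw _ HA erefl; rewrite /= in EA HS.
  elim: H Hc z0 => [{}c {}z Hz|{}c d {}z HR Hs _ IH] Hc z0; first exact: run_done.
  suff [Hs' Hd] : cstep P' c d /\ inr (inl S) \notin d by apply: run_step HR Hs' (IH Hd z0).
  elim: Hs Hc {IH HR} => [|i w {}c {}d Hi _ IH]; first by split=> //; constructor.
  rewrite inE negb_or => /andP [Ei /IH [Hs' Hd]].
  rewrite mem_cat negb_or Hd andbT.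
  case: Hi Ei => [a|a|B {}w HB] EB.
  - by split=> //; apply: cstep_cons => //; constructor.
  - by split=> //; apply: cstep_cons => //; constructor.
  split; last first.
    by rewrite mem_map; [exact: (HS _ HB) | move=> ? ? []].
  apply: cstep_cons => //; apply: istep_node; rewrite mem_filter HB andbT /=.
  by apply/eqP => w0; case: (Gw _ HB w0) EB => /= ->; rewrite eqxx.
case: (classic (exists A, (A, [::]) \in P)) => [HE|HE]; last first.
  apply: run_mono => -[A w] HA; rewrite mem_filter HA andbT /=.
  by apply/eqP => w0; apply: HE; exists A; rewrite -w0.
move Ec: [:: _] => c Hr; case: Hr z0 H Ec => {z c} [c z Hz|c d z HR Hs Hd] z0 H Ec.
  exact: run_done.
have [A HA] := HE; have [EA HS] := Gw _ HA erefl.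
rewrite -Ec in HR Hs *; inversion Hs as [|i w c' d' Hi Hc']; subst.
inversion Hc'; subst; rewrite cats0 in Hs Hd *.
inversion Hi as [| |B v HB]; subst.
apply: run_step HR _ (H _ HE _ Hd).
  apply: cstep_item; apply: istep_node; rewrite mem_filter HB andbT /=.
  apply/eqP => w0; rewrite w0 /= in Hd.
  by apply: z0; apply: run_nil Hd.
rewrite mem_map; [exact: (HS _ HB) | by move=> ? ? []].
Qed.

Lemma cs_of_tc (T : finType) (L : seq T -> Prop) : in_TC_UF L -> in_CS L.
Proof.
case=> N [G [Gw [e He] HL]].
have [Q [st [i [f Hst]]]] := uf_lang_epath e.
set P' := [seq r <- tc_rules G | r.2 != [::]].
have P'_ne A w : (A, w) \in P' -> w <> [::] by rewrite mem_filter => /andP [/eqP].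
have [B HB] := trel1_bounded P' st i f.
have [N' [G' [Gw' HG']]] := cs_of_two_cell_system (@trel2 N T Q) (start T (tc_start G) Q)
  (L [::]) (@trel1_nonerasing _ _ P' _ st i f) HB.
exists N', G'; split=> // z; rewrite HG'.
have HR w : epath st i w f <-> tc_control G w by rewrite -Hst He.
have runR P c y : run P (R st i f) c y <-> run P (tc_control G) c y.
  by split; elim=> [{}c {}y|{}c d {}y /HR HRc Hs _]; [exact: run_done|exact: run_step|
     exact: run_done|exact: run_step].
rewrite sweep_iff_run // runR; split=> [|[Hz|[-> //]]].
  have [-> |/eqP z0] := eqVneq z [::]; first by right.
  by move/HL/tc_lang_run/(run_nonerasing Gw z0); left.
apply/HL/tc_lang_run; apply: run_mono Hz; exact: mem_subseq (filter_subseq _ _).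
Qed.

(** * From context-sensitive to tree-controlled grammars *)

Section FiniteStar.
Variable V : eqType.

Definition star_of (W : seq (seq V)) (w : seq V) : Prop :=
  exists2 ws, {subset ws <= W} & w = flatten ws.

Lemma star_of_cat W u v : star_of W u -> star_of W v -> star_of W (u ++ v).
Proof.
case=> us Hu -> [vs Hv ->]; exists (us ++ vs); last by rewrite flatten_cat.
by move=> x; rewrite mem_cat => /orP [/Hu|/Hv].
Qed.

(* Union-free since (w1 | ... | wn)* = (w1* ... wn* )*. *)
Lemma union_free_star_of W : union_free (star_of W).
Proof.
pose word := foldr (fun (a : V) => UF_cat (UF_sym a)) (UF_star (UF_empty V)).
pose body := foldr (fun w => UF_cat (UF_star (word w))) (UF_star (UF_empty V)).
have star_ind e (Q : seq V -> Prop) : Q [::] ->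
    (forall u v, uf_lang e u -> Q v -> Q (u ++ v)) -> forall w, uf_lang (UF_star e) w -> Q w.
  move=> Q0 QS w; move Ee: (UF_star e) => e' H; elim: H Ee => // e1 u v Hu _ _ IH [Ee].
  by apply: QS; [rewrite Ee | apply: IH; rewrite Ee].
have empty_star w : uf_lang (UF_star (UF_empty V)) w -> w = [::].
  by apply: (star_ind _ (fun w => w = [::])) => // u v H; inversion H.
have wordP w x : uf_lang (word w) x <-> x = w.
  elim: w x => [|a w IH] x; first by split=> [/empty_star|->] //; constructor.
  split=> [H|->]; last by apply: (@UFL_cat _ _ _ [:: a]); [constructor | apply/IH].
  by inversion H as [|e1 e2 u v Hu Hv| |]; inversion Hu; rewrite (proj1 (IH _) Hv).
have body0 W' : uf_lang (body W') [::].
  by elim: W' => [|x W' IH] /=; [|apply: (@UFL_cat _ _ _ [::])]; try constructor.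
have bodyP w : w \in W -> uf_lang (body W) w.
  elim: W => //= x W IH; rewrite inE => /orP [/eqP ->|/IH Hw].
    have := UFL_cat (UFL_star_cons (proj2 (wordP x x) erefl) (UFL_star_nil _)) (body0 W).
    by rewrite !cats0.
  exact: (UFL_cat (UFL_star_nil (word x)) Hw).
have bodyS w : uf_lang (body W) w -> star_of W w.
  elim: W w {bodyP} => [|x W IH] w /=; first by move/empty_star=> ->; exists [::].
  move=> H; inversion H as [|e1 e2 u v Hu Hv| |]; subst.
  have [vs {}Hv ->] := IH _ Hv; apply: star_of_cat.
    move: u Hu {H}; apply: (star_ind _ (star_of (x :: W))) => [|u v' /wordP -> Hv']; first by exists [::].
    apply: star_of_cat => //; exists [:: x]; last by rewrite /= cats0.
    by move=> y; rewrite !inE => ->.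
  by exists vs => // y /Hv Hy; rewrite inE Hy orbT.
exists (UF_star (body W)) => w; split.
  case=> ws Hws ->; elim: ws Hws => [|x ws IH] Hws; first by constructor.
  apply: UFL_star_cons; first by apply/bodyP/Hws; rewrite inE eqxx.
  by apply: IH => y Hy; apply: Hws; rewrite inE Hy orbT.
by apply: (star_ind _ (star_of W)) => [|u v /bodyS]; [exists [::] | apply: star_of_cat].
Qed.

End FiniteStar.

Section ParallelSteps.
Variables (N T : eqType) (P : seq (N * seq (N + T))).

Lemma cstep_split c c' d : cstep P (c ++ c') d ->
  exists d1 d2, [/\ d = d1 ++ d2, cstep P c d1 & cstep P c' d2].
Proof.
elim: c d => [|i c IH] d /= H; first by exists [::], d; split=> //; constructor.
inversion H as [|i' w c1 d' Hi Hc]; subst; have [d1 [d2 [-> H1 H2]]] := IH _ Hc.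
by exists (w ++ d1), d2; rewrite catA; split=> //; constructor.
Qed.

Lemma cstep_map (I : eqType) (s : seq I) (A : I -> N) g :
  (forall x, x \in s -> (A x, g x) \in P) ->
  cstep P [seq inr (inl (A x)) | x <- s] (map inr (flatten (map g s))).
Proof.
elim: s => [|x s IH] H /=; first by constructor.
rewrite map_cat; apply: cstep_cons.
  by apply: istep_node; apply: H; rewrite inE eqxx.
by apply: IH => y Hy; apply: H; rewrite inE Hy orbT.
Qed.

Lemma cstep_map_inv (I : eqType) (s : seq I) (A : I -> N) g d :
  (forall x w, x \in s -> (A x, w) \in P -> w = g x) ->
  cstep P [seq inr (inl (A x)) | x <- s] d -> d = map inr (flatten (map g s)).
Proof.
elim: s d => [|x s IH] d Hg /= H; first by inversion H.
inversion H as [|i' w c1 d' Hi Hc]; subst; rewrite (IH _ _ Hc); last first.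
  by move=> y v Hy; apply: Hg; rewrite inE Hy orbT.
rewrite map_cat; congr (_ ++ _); inversion Hi as [| |A' v HA]; subst.
by rewrite (Hg x v) // inE eqxx.
Qed.

End ParallelSteps.

Section Blocks.
Variables (N T : finType) (G : cs_grammar N T).
Let S := cs_start G.
Let X := (N + T)%type.
Let rule := seq_sub (cs_rules G).

Definition lhs (r : rule) : seq X := let: (u, A, v, w) := ssval r in u ++ inl A :: v.
Definition site (r : rule) : nat := let: (u, A, v, w) := ssval r in size u.
Definition body (r : rule) : seq X := let: (u, A, v, w) := ssval r in w.
Definition image (r : rule) (k : nat) : seq X :=
  if k == site r then body r else [:: nth (inl S) (lhs r) k].

Definition width : nat := \max_(r : rule) size (lhs r).

Definition bnt : finType := option (X + rule * 'I_width.+1).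
Definition plain_nt (x : X) : bnt := Some (inl x).
Definition mark_nt (r : rule) (k : nat) : bnt := Some (inr (r, inord k)).
Definition plainw (w : seq X) : seq (bnt + T) := [seq inl (plain_nt x) | x <- w].
Definition block (r : rule) : seq (bnt + T) :=
  [seq inl (mark_nt r k) | k <- iota 0 (size (lhs r))].

Definition has_empty : Prop := ([::], S, [::], [::]) \in cs_rules G.

Inductive brel : bnt * seq (bnt + T) -> Prop :=
  | brel_start : brel (None, plainw [:: inl S])
  | brel_empty : has_empty -> brel (None, [::])
  | brel_keep x : brel (plain_nt x, plainw [:: x])
  | brel_mark r k : k < size (lhs r) -> brel (plain_nt (nth (inl S) (lhs r) k), [:: inl (mark_nt r k)])
  | brel_apply r (k : 'I_width.+1) : body r <> [::] ->
      brel (Some (inr (r, k)), plainw (image r k))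
  | brel_leaf a : brel (plain_nt (inr a), [:: inr a]).

Definition code : seq (seq (bnt + T)) :=
  [:: inl None] :: [seq plainw [:: x] | x <- enum {: X}] ++ [seq block r | r <- enum {: rule}].

Lemma brel_finite : exists l : seq (bnt * seq (bnt + T)), forall r, r \in l <-> brel r.
Proof.
pose B := maxn 1 (\max_(r : rule) size (body r)).
have [l Hl] := @bounded_words (bnt + T)%type B.
have [l' Hl'] := finite_comprehension [seq (A, w) | A <- enum bnt, w <- l] brel.
exists l' => -[A w]; rewrite Hl'; split=> [[]//|H]; split=> //.
apply/allpairsP; exists (A, w); rewrite mem_enum; split=> //=; apply: Hl.
rewrite -[w]/(A, w).2; case: H => [|_|x|r k _|r k _|a] //=; rewrite ?leq_max //.
rewrite size_map /image; case: ifP => _ //=.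
by rewrite (leq_bigmax (F := fun r => size (body r)) r) orbT.
Qed.

Variable P : seq (bnt * seq (bnt + T)).
Hypothesis HP : forall r, r \in P <-> brel r.

Definition dec (y : bnt + T) : X :=
  match y with
  | inl None => inl S
  | inl (Some (inl x)) => x
  | inl (Some (inr (r, k))) => nth (inl S) (lhs r) k
  | inr a => inr a
  end.

Notation "x =>* y" := (clos_refl_trans _ (cs_step G) x y) (at level 70).

Lemma cs_context p q x y : x =>* y -> p ++ x ++ q =>* p ++ y ++ q.
Proof.
apply: (clos_rt_map (f := fun x => p ++ x ++ q)) => {}x {}y.
case=> p' [q' [u [v [w [A [HA -> ->]]]]]]; apply: rt_step.
by exists (p ++ p'), (q' ++ q), u, v, w, A; rewrite !catA.
Qed.

Lemma cs_cat x x' y y' : x =>* y -> x' =>* y' -> x ++ x' =>* y ++ y'.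
Proof.
move=> H H'; apply: (rt_trans _ _ _ (y ++ x')); first exact: (cs_context [::]).
by have := cs_context y [::] H'; rewrite !cats0.
Qed.

Lemma size_lhs r : size (lhs r) <= width.
Proof. exact: (leq_bigmax (F := fun r => size (lhs r))). Qed.

Lemma dec_plainw w : map dec (plainw w) = w.
Proof. by rewrite -map_comp map_id. Qed.

Lemma inord_lhs r k : k < size (lhs r) -> nat_of_ord (inord k : 'I_width.+1) = k.
Proof. by move=> Hk; rewrite inordK // ltnS ltnW // (leq_trans Hk) // size_lhs. Qed.

Lemma dec_block r : map dec (block r) = lhs r.
Proof.
rewrite -map_comp -[RHS](mkseq_nth (inl S)); apply/eq_in_map => k; rewrite mem_iota /= => Hk.
by rewrite (inord_lhs Hk).
Qed.

Lemma flatten_image r : let: (u, A, v, w) := ssval r in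
  flatten [seq image r k | k <- iota 0 (size (lhs r))] = u ++ w ++ v.
Proof.
rewrite /image /site /body /lhs; case: (ssval r) => [[[u A] v] w].
rewrite size_cat /= iotaD map_cat flatten_cat /= eqxx add0n.
congr (_ ++ (_ ++ _)).
  rewrite -[RHS]flatten_seq1 -[in RHS](mkseq_nth (inl S) u) -map_comp; congr flatten.
  apply/eq_in_map => k; rewrite mem_iota /= add0n => Hk.
  by rewrite nth_cat Hk ltn_eqF.
rewrite -[RHS]flatten_seq1 -[in RHS](mkseq_nth (inl S) v) -map_comp.
rewrite -[(size u).+1]addn0 iotaDl -map_comp; congr flatten.
apply/eq_in_map => k _; rewrite /= addSnnS nth_cat ltnNge leq_addr /= addKn.
by rewrite gtn_eqF // -[X in X < _]addn0 ltn_add2l.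
Qed.

Lemma image_step p q r : body r <> [::] ->
  p ++ lhs r ++ q =>* p ++ flatten [seq image r k | k <- iota 0 (size (lhs r))] ++ q.
Proof.
move=> Hr; move: (flatten_image r) (ssvalP r); rewrite {2}/lhs.
case: (ssval r) => [[[u A] v] w] -> HG; apply: rt_step.
by exists p, q, u, v, w, A; rewrite -!catA.
Qed.

Definition ctrl := star_of code.

Lemma code_step c d : c \in code -> inl None \notin c -> cstep P (map inr c) d ->
  exists y, [/\ d = map inr y, inl None \notin y & map dec c =>* map dec y].
Proof.
have plainN w : inl None \notin plainw w by apply/mapP => -[].
rewrite inE mem_cat => /orP [/eqP -> //|/orP []] /mapP [x _ ->] {c} Hc.
  have -> : map inr (plainw [:: x]) = [seq inr (inl (plain_nt y)) | y <- [:: x]] by [].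
  rewrite /= => H; inversion H as [|i w c e Hi He]; subst; inversion He; subst; rewrite cats0.
  inversion Hi as [| |A v HA]; subst; exists v; split=> //.
    by move/HP: HA => HA; inversion HA; subst; rewrite ?plainN.
  move/HP: HA; move E: (_, v) => rv HA.
  case: HA E => [|_|y|r k Hk|r k _|a] // [-> ->]; try exact: rt_refl.
  by rewrite /= (inord_lhs Hk); exact: rt_refl.
move=> H; rewrite {1}/block -map_comp in H.
have ok k w : k \in iota 0 (size (lhs x)) -> (mark_nt x k, w) \in P ->
    w = plainw (image x k) /\ body x <> [::].
  rewrite mem_iota /= => Hk /HP; move E: (_, w) => rv HA.
  by case: HA E => [|_|y|r k' _|r k' Hb|a] // [-> Ek ->]; rewrite -Ek (inord_lhs Hk) in Hb *.
have Hb : body x <> [::].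
  have Hs : 0 < size (lhs x).
    by rewrite /lhs; case: (ssval x) => [[[u A] v] w]; rewrite size_cat addnS.
  case En: (size (lhs x)) Hs H ok => [//|n] _ H ok.
  inversion H as [|i w c1 d' Hi _]; subst; inversion Hi as [| |A w' HA]; subst.
  by case: (ok 0 w' _ HA); rewrite ?mem_iota.
exists (flatten [seq plainw (image x k) | k <- iota 0 (size (lhs x))]); split.
- apply: (@cstep_map_inv _ _ P _ _ (mark_nt x) (fun k => plainw (image x k)) d _ H) => k w Hk.
  by case/(ok _ _ Hk).
- by apply/negP => /flattenP [w /mapP [k _ ->]]; apply/negP.
rewrite dec_block map_flatten -map_comp.
rewrite (eq_map (g := image x)) => [|k]; last by rewrite /= dec_plainw.
by have := image_step [::] [::] Hb; rewrite !cats0.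
Qed.

Lemma ctrl_step x d : ctrl x -> inl None \notin x -> cstep P (map inr x) d ->
  exists y, [/\ d = map inr y, inl None \notin y & map dec x =>* map dec y].
Proof.
case=> ws Hws -> {x}; elim: ws d Hws => [|w ws IH] d Hws /= Hn H.
  by inversion H; exists [::]; split=> //; exact: rt_refl.
move: Hn; rewrite mem_cat negb_or => /andP [Hn Hn'].
rewrite map_cat in H; have [d1 [d2 [-> H1 H2]]] := cstep_split H.
have [y1 [-> N1 S1]] := code_step (Hws _ (mem_head _ _)) Hn H1.
have [|y2 [-> N2 S2]] := IH _ _ Hn' H2.
  by move=> v Hv; apply: Hws; rewrite inE Hv orbT.
exists (y1 ++ y2); split; first by rewrite map_cat.
  by rewrite mem_cat negb_or N1.
by rewrite !map_cat; apply: cs_cat.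
Qed.

Lemma run_sound x z : inl None \notin x -> run P ctrl (map inr x) z ->
  map dec x =>* map inr z.
Proof.
move=> Hx; move Ec: (map _ x) => c H; elim: H x Hx Ec => {c z} [c z Hz|c d z HR Hs _ IH] x Hx Ec.
  have -> : map inr z = map dec x; last exact: rt_refl.
  rewrite -{}Ec in Hz; elim: x z Hz {Hx} => [|X' x IH] [|a z] //= [EX /IH ->].
  by case: X' EX => // b [->].
rewrite -Ec active_map_inr in HR Hs *.
by have [y [Ed Hy Hxy]] := ctrl_step HR Hx Hs; apply: rt_trans Hxy (IH _ Hy (esym Ed)).
Qed.

Lemma tc_sound z : run P ctrl [:: inr (inl None)] z ->
  z = [::] /\ has_empty \/ [:: inl S] =>* map inr z.
Proof.
move Ec: [:: _] => c H; case: H Ec => {c z} [[|? ?] [|a z] // [Hz _] [EX]|c d z HR Hs Hd Ec].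
  by rewrite -EX in Hz.
rewrite -Ec in Hs; inversion Hs as [|i w c' d' Hi Hc']; subst.
inversion Hc'; subst; rewrite cats0 in Hs Hd *.
inversion Hi as [| |B v HB]; subst.
move/HP: HB; move E: (_, v) => rv HB; case: HB E Hd => [|HE|y|r k Hk|r k _|a] // [->] Hd.
  by right; apply: (run_sound (x := plainw [:: inl S]) _ Hd).
by left; split=> //; apply: run_nil Hd.
Qed.

Lemma ctrl_cat x y : ctrl x -> ctrl y -> ctrl (x ++ y).
Proof. exact: star_of_cat. Qed.

Lemma ctrl_code x : x \in code -> ctrl x.
Proof.
by move=> Hx; exists [:: x]; rewrite /= ?cats0 // => y; rewrite inE => /eqP ->.
Qed.

Lemma ctrl_plainw w : ctrl (plainw w).
Proof.
elim: w => [|x w IH]; first by exists [::].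
apply: (@ctrl_cat [:: _]) IH; apply: ctrl_code; rewrite inE mem_cat.
by apply/orP; right; apply/orP; left; apply/mapP; exists x; rewrite ?mem_enum.
Qed.

Lemma ctrl_block r : ctrl (block r).
Proof.
apply: ctrl_code; rewrite inE mem_cat.
by apply/orP; right; apply/orP; right; apply/mapP; exists r; rewrite ?mem_enum.
Qed.

Lemma cstep_plainw w : cstep P (map inr (plainw w)) (map inr (plainw w)).
Proof.
have := @cstep_map _ _ P _ w plain_nt (fun x => plainw [:: x]).
rewrite flatten_map1 /plainw -!map_comp; apply=> x _.
by apply/HP; constructor.
Qed.

Lemma cstep_mark r : cstep P (map inr (plainw (lhs r))) (map inr (block r)).
Proof.
have := @cstep_map _ _ P _ (iota 0 (size (lhs r))) (fun k => plain_nt (nth (inl S) (lhs r) k))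
  (fun k => [:: inl (mark_nt r k)]).
rewrite flatten_map1 -[in plainw (lhs r)](mkseq_nth (inl S) (lhs r)) /plainw -!map_comp.
by apply=> k; rewrite mem_iota => Hk; apply/HP; constructor.
Qed.

Lemma cstep_apply r : body r <> [::] -> cstep P (map inr (block r))
  (map inr (plainw (flatten [seq image r k | k <- iota 0 (size (lhs r))]))).
Proof.
move=> Hr; rewrite {1}/block -map_comp [plainw _]map_flatten -map_comp.
apply: (@cstep_map _ _ P _ _ (mark_nt r) (fun k => plainw (image r k))) => k.
rewrite mem_iota /= => Hk; apply/HP.
by rewrite -{2}(inord_lhs Hk); exact: brel_apply.
Qed.

Lemma run_plainw_leaves z : run P ctrl (map inr (plainw (map inr z))) z.
Proof.
apply: (@run_step _ _ _ _ _ (map inr (map inr z))).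
- by rewrite active_map_inr; apply: ctrl_plainw.
- have := @cstep_map _ _ P _ z (fun a => plain_nt (inr a)) (fun a => [:: inr a]).
  rewrite flatten_map1 /plainw -!map_comp; apply=> a _; apply/HP; constructor.
by apply: run_done; rewrite -!map_comp.
Qed.

Lemma plainw_cat x y : plainw (x ++ y) = plainw x ++ plainw y.
Proof. exact: map_cat. Qed.

Lemma run_plainw_rule r p q z : body r <> [::] ->
  run P ctrl (map inr (plainw (p ++ flatten [seq image r k | k <- iota 0 (size (lhs r))] ++ q))) z ->
  run P ctrl (map inr (plainw (p ++ lhs r ++ q))) z.
Proof.
move=> Hr Hz.
apply: (@run_step _ _ _ _ _ (map inr (plainw p ++ block r ++ plainw q))).
- by rewrite active_map_inr; apply: ctrl_plainw.
- rewrite !plainw_cat !map_cat; apply: cstep_cat; first exact: cstep_plainw.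
  by apply: cstep_cat; [exact: cstep_mark | exact: cstep_plainw].
apply: run_step Hz.
- rewrite active_map_inr; apply: ctrl_cat; first exact: ctrl_plainw.
  by apply: ctrl_cat; [exact: ctrl_block | exact: ctrl_plainw].
rewrite !plainw_cat !map_cat; apply: cstep_cat; first exact: cstep_plainw.
by apply: cstep_cat; [exact: cstep_apply | exact: cstep_plainw].
Qed.

Hypothesis Gw : cs_wellformed G.

Lemma cs_from_nil y : clos_refl_trans_1n _ (cs_step G) [::] y -> y = [::].
Proof.
move E: (@nil X) => n H; case: H E => // x' y' [p [q [u [v [w [A [_ -> _]]]]]]] _.
by case: p => //; case: u.
Qed.

Lemma has_empty_of_derivation x : x =>* [::] -> x <> [::] -> has_empty.
Proof.
move/clos_rt_rt1n_iff; move E: (@nil X) => n H; elim: H E => {x n} [x <- //|x x' n [p [q [u [v [w [A [HA Ex Ex']]]]]]] _ IH E _].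
have [x0|/eqP x0] := eqVneq x' [::]; last by apply: IH => //; rewrite -E.
have w0 : w = [::] by move: Ex'; rewrite x0; case: (p) => //; case: (u) => //; case: (w).
by subst w; have [u0 v0 EA _] := Gw HA erefl; subst u v A.
Qed.

Lemma run_plainw_derivation x z : z <> [::] ->
  (has_empty -> inl S \notin x \/ x = [:: inl S]) -> x =>* map inr z ->
  run P ctrl (map inr (plainw x)) z.
Proof.
move=> z0 HE /clos_rt_rt1n_iff; move Ey: (map _ z) => y H.
elim: H HE Ey => {x y} [y|x x' y [p [q [u [v [w [A [HA Ex Ex']]]]]]] Hy IH] HE Ey.
  by rewrite -Ey => *; apply: run_plainw_leaves.
have [w0|/eqP w0] := eqVneq w [::].
  case: (Gw HA w0) => u0 v0 EA _; subst u v w A.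
  have {}HE : x = [:: inl S].
    by case: (HE HA) => //; rewrite Ex !mem_cat inE eqxx !orbT.
  rewrite Ex in HE; have [Ep _ _ Eq] := cat_cons_eq_singleton (v := [::]) (u := [::]) HE.
  rewrite Ex' Ep Eq in Hy; case: z0; move/(congr1 size): Ey.
  by rewrite (cs_from_nil Hy) size_map => /size0nil.
pose r : rule := SeqSub HA.
have := flatten_image r; rewrite /= => Ef.
have -> : x = p ++ lhs r ++ q by rewrite Ex /lhs /= -!catA.
apply: run_plainw_rule => //; rewrite Ef -!catA -Ex'; apply: IH => // HE'; left.
have Hr : inl S \notin u ++ w ++ v by case: (Gw HE' erefl) => _ _ _ /(_ _ HA).
have Hpq : (inl S \notin p) && (inl S \notin q).
  case: (HE HE'); rewrite Ex; last by move/(@cat_cons_eq_singleton X) => [] -> _ _ ->.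
  by rewrite !mem_cat !negb_or => /andP [-> /andP [_ /andP [_ /andP [_ ->]]]].
move: Hpq Hr; rewrite Ex' !mem_cat !negb_or => /andP [-> ->] /andP [-> /andP [-> ->]] //.
Qed.

Lemma tc_complete z : z <> [::] -> [:: inl S] =>* map inr z ->
  run P ctrl [:: inr (inl None)] z.
Proof.
move=> z0 /(run_plainw_derivation z0) H0.
apply: (@run_step _ _ _ _ _ (map inr (plainw [:: inl S]))).
- by apply: (ctrl_code (x := [:: inl None])); rewrite inE eqxx.
- by apply: cstep_item; apply: istep_node; apply/HP; constructor.
by apply: H0; right.
Qed.

Lemma run_iff_cs_lang z : run P ctrl [:: inr (inl None)] z <-> cs_lang G z.
Proof.
have HE0 : has_empty -> [:: inl S] =>* map inr [::].
  by move=> HE; apply: rt_step; exists [::], [::], [::], [::], [::], S.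
split=> [/tc_sound [[-> /HE0]|] //|Hz].
have [z0|/eqP z0] := eqVneq z [::]; last exact: tc_complete.
have HE : has_empty by rewrite z0 in Hz; apply: has_empty_of_derivation Hz _.
rewrite z0; apply: (@run_step _ _ _ _ _ [::]); last exact: run_done.
  by apply: (ctrl_code (x := [:: inl None])); rewrite inE eqxx.
by apply: (cstep_item (w := map inr [::])); apply: istep_node; apply/HP; constructor.
Qed.

End Blocks.

Lemma tc_of_cs (T : finType) (L : seq T -> Prop) : in_CS L -> in_TC_UF L.
Proof.
case=> N [G [Gw HL]]; have [P HP] := brel_finite G.
exists (bnt G), (TCGrammar P None (@ctrl N T G)); split; last 1 first.
- by move=> z; rewrite HL tc_lang_run run_iff_cs_lang.
- move=> [A w] /= /HP; move E: (A, w) => r HA Ew; subst w.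
  have HS r' : r' \in P -> inl None \notin r'.2.
    by move/HP; case=> [|_|x|r1 k _|r1 k _|a] //=; apply/mapP => -[].
  case: HA E => [|_|x|r1 k _|r1 k Hr|a] // [->] //; last first.
    by rewrite /image; case: ifP => // _; move: Hr; case: (body r1).
exact: union_free_star_of.
Qed.

(* TC(UF) = CS : for every finite terminal alphabet T, a language over T is
   generated by a tree-controlled grammar with union-free control language
   iff it is context-sensitive. *)
Theorem mainTheorem3 (T : finType) (L : seq T -> Prop) :
  in_TC_UF L <-> in_CS L.
Proof. by split; [exact: cs_of_tc | exact: tc_of_cs]. Qed.
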